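(* Any bounded lattice morphism whose image is $\{0,1\}$ is admissible and Max-admissible; that is, if $L$ and $M$ are bounded lattices and $h:L\to M$ is a bounded lattice morphism with $h(L)=\{0,1\}$, then $h$ is admissible and Max-admissible.
   Context: Lattices are non-empty; bounded lattice morphisms preserve $0$ and $1$. $\mathrm{Con}(L)$ is the lattice of congruences of $L$ ordered by inclusion, with greatest element $\nabla_L=L^2$. $\mathrm{Max}(L)$ is the set of maximal elements of $\mathrm{Con}(L)\setminus\{\nabla_L\}$. Since the commutator of congruences of a lattice is the intersection, a congruence $\phi\neq\nabla_L$ is prime iff, for all $\alpha,\beta\in \mathrm{Con}(L)$, $\alpha\cap\beta\subseteq\phi$ implies $\alpha\subseteq\phi$ or $\beta\subseteq\phi$; $\mathrm{Spec}(L)$ is the set of prime congruences of $L$. For $\psi\in \mathrm{Con}(M)$, $h^*(\psi)=\{(a,b)\in L^2 : (h(a),h(b))\in\psi\}\in \mathrm{Con}(L)$. The morphism $h:L\to M$ is admissible if $h^*(\psi)\in \mathrm{Spec}(L)$ for all $\psi\in \mathrm{Spec}(M)$, and Max-admissible if $h^*(\psi)\in \mathrm{Max}(L)$ for all $\psi\in \mathrm{Max}(M)$. *)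

(* Defs.v *)
From mathcomp Require Import all_boot all_order.
From mathcomp Require Import boolp classical_sets.

Local Open Scope classical_set_scope.

(* A congruence is a subset of L * L, so that inclusion, intersection and
   equality of congruences are those of sets, and the full congruence L ^ 2
   is [set: L * L]. *)
Record is_congruence {d : Order.disp_t} {L : latticeType d}
    (theta : set (L * L)) : Prop := IsCongruence {
  congruence_refl : forall a, theta (a, a) ;
  congruence_sym : forall a b, theta (a, b) -> theta (b, a) ;
  congruence_trans : forall a b c,
    theta (a, b) -> theta (b, c) -> theta (a, c) ;
  congruence_meet : forall a b a' b',
    theta (a, b) -> theta (a', b') -> theta (a `&` a', b `&` b')%O ;
  congruence_join : forall a b a' b',
    theta (a, b) -> theta (a', b') -> theta (a `|` a', b `|` b')%O
}.

Definition Con {d : Order.disp_t} (L : latticeType d) : set (set (L * L)) :=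
  [set theta | is_congruence theta].

(* [A `\ x] removes the single element [x] from [A]: below, Con(L) without the
   full congruence. *)
Definition Max {d : Order.disp_t} (L : latticeType d) : set (set (L * L)) :=
  [set phi | (Con L `\ [set: L * L]) phi /\
     forall psi, (Con L `\ [set: L * L]) psi ->
       phi `<=` psi -> psi = phi].

(* The commutator of two congruences of a lattice is their intersection,
   whence the intersection in place of the commutator below. *)
Definition Spec {d : Order.disp_t} (L : latticeType d) : set (set (L * L)) :=
  [set phi | (Con L `\ [set: L * L]) phi /\
     forall alpha beta, Con L alpha -> Con L beta ->
       alpha `&` beta `<=` phi ->
       alpha `<=` phi \/ beta `<=` phi].

Definition pullback {d d' : Order.disp_t} {L : latticeType d}
    {M : latticeType d'} (h : L -> M) (psi : set (M * M)) : set (L * L) :=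
  [set ab | psi (h ab.1, h ab.2)].

Definition admissible {d d' : Order.disp_t} {L : latticeType d}
    {M : latticeType d'} (h : L -> M) : Prop :=
  forall psi, Spec M psi -> Spec L (pullback h psi).

Definition Max_admissible {d d' : Order.disp_t} {L : latticeType d}
    {M : latticeType d'} (h : L -> M) : Prop :=
  forall psi, Max M psi -> Max L (pullback h psi).

(* Main.v *)
Require Import Defs.
From mathcomp Require Import all_boot all_order.
From mathcomp Require Import boolp classical_sets.

(** A congruence of a bounded lattice identifying 0 and 1 is full, so when
    [h(L) = {0, 1}] the pullback of every proper congruence is the kernel of
    [h], whose quotient has two elements.  Maximality follows.  For primality,
    a congruence not inside the kernel contains some [(a, b)] with [a <= b],
    [h a = 0] and [h b = 1]; if [(c, e)] is such a pair for another congruence,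
    then [((a /\ e) \/ (b /\ c), b /\ e)] lies in both and not in the kernel. *)

Import Order.Theory.
Local Open Scope classical_set_scope.
Local Open Scope order_scope.

Lemma congruence_bot_top (d : Order.disp_t) (L : tbLatticeType d)
    (theta : set (L * L)) :
  Con L theta -> theta (\bot, \top) -> theta = [set: L * L].
Proof.
move=> cth th01; apply/seteqP; split=> // -[a b] _.
(* Meeting the pair [(\bot, \top)] with [(x, x)] makes every [x] congruent to [\bot]. *)
have th0 x : theta (\bot, x).
  have := congruence_meet _ cth _ _ _ _ th01 (congruence_refl _ cth x).
  by rewrite meet0x meet1x.
by apply: (congruence_trans _ cth _ \bot); first apply: (congruence_sym _ cth).
Qed.

Lemma pullback_Con (d d' : Order.disp_t) (L : latticeType d)
    (M : latticeType d') (h : {lmorphism L -> M}) (psi : set (M * M)) :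
  Con M psi -> Con L (pullback h psi).
Proof.
move=> cpsi; split; rewrite /pullback /=.
- by move=> a; apply: (congruence_refl _ cpsi).
- by move=> a b; apply: (congruence_sym _ cpsi).
- by move=> a b c; apply: (congruence_trans _ cpsi).
- by move=> *; rewrite !omorphI; apply: (congruence_meet _ cpsi).
- by move=> *; rewrite !omorphU; apply: (congruence_join _ cpsi).
Qed.

Section TwoElementImage.
Variables (d d' : Order.disp_t) (L : tbLatticeType d) (M : tbLatticeType d').
Variable h : {lmorphism L -> M}.
Hypotheses (h0 : h \bot = \bot) (h1 : h \top = \top).
Hypothesis hL : range h = [set \bot; \top].
Variable psi : set (M * M).
Hypothesis psi_proper : (Con M `\ [set: M * M]) psi.

Let K := pullback h psi.

Let h01 x : h x = \bot \/ h x = \top.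
Proof. by have : range h (h x) by []; rewrite hL. Qed.

Lemma pullback_proper : (Con L `\ [set: L * L]) K.
Proof.
have [cpsi npsi] := psi_proper; split; first exact: pullback_Con.
move=> KT; apply: npsi; apply: congruence_bot_top => //.
have : K (\bot, \top) by rewrite KT.
by rewrite /K /pullback /= h0 h1.
Qed.

Lemma not_sub_pullback (theta : set (L * L)) :
  Con L theta -> ~ theta `<=` K ->
  exists a b, [/\ a <= b, theta (a, b), h a = \bot & h b = \top].
Proof.
have [cpsi _] := psi_proper.
move=> cth /existsNP[[a b]] /not_implyP[thab nK].
(* If [h a = h b], reflexivity of [psi] puts [(a, b)] in [K]; so the two images are [\bot] and
   [\top] in some order, and symmetry of [theta] and [psi] allows a swap. *)
wlog [ha hb] : a b thab nK / h a = \bot /\ h b = \top.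
  move=> W.
  have nKba : ~ K (b, a) by move=> /(congruence_sym _ cpsi).
  have thba := congruence_sym _ cth _ _ thab.
  have [[ha|ha] [hb|hb]] := (h01 a, h01 b);
    [exfalso | exact: (W a b) | exact: (W b a) | exfalso]; apply: nK;
    by rewrite /K /pullback /= ha hb; apply: (congruence_refl _ cpsi).
(* Meeting [(a, b)] with [(b, b)] makes the pair comparable without changing its images. *)
exists (a `&` b), b; split=> //; first exact: leIr.
- have := congruence_meet _ cth _ _ _ _ thab (congruence_refl _ cth b).
  by rewrite meetxx.
- by rewrite omorphI /= ha meet0x.
Qed.

Lemma not_pullback (a b : L) : h a = \bot -> h b = \top -> ~ K (a, b).
Proof.
have [cpsi npsi] := psi_proper.
rewrite /K /pullback /= => -> -> psi01.
by apply: npsi; apply: congruence_bot_top.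
Qed.

Lemma pullback_Max : Max L K.
Proof.
have [cpsi _] := psi_proper.
split=> [|theta [cth nth] Kth]; first exact: pullback_proper.
apply/seteqP; split=> //; apply: contrapT => /(not_sub_pullback _ cth).
move=> [a [b [_ thab ha hb]]]; apply: nth; apply: congruence_bot_top => //.
(* The chain [\bot], [a], [b], [\top]: the outer links lie in [K], hence in [theta], because their
   ends have equal images; the middle one is [thab]. *)
apply: (congruence_trans _ cth _ a); last apply: (congruence_trans _ cth _ b).
- by apply: Kth; rewrite /K /pullback /= h0 ha; apply: (congruence_refl _ cpsi).
- exact: thab.
- by apply: Kth; rewrite /K /pullback /= h1 hb; apply: (congruence_refl _ cpsi).
Qed.

Lemma pullback_Spec : Spec L K.
Proof.
split=> [|al be cal cbe sK]; first exact: pullback_proper.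
apply: contrapT => /not_orP[/(not_sub_pullback _ cal)[a [b [ab alab ha hb]]]].
move=> /(not_sub_pullback _ cbe)[c [e [ce bece hc he]]].
apply: (@not_pullback ((a `&` e) `|` (b `&` c)) (b `&` e)).
- by rewrite omorphU !omorphI /= ha hc meet0x meetx0 joinxx.
- by rewrite omorphI /= hb he meetxx.
apply: sK; split.
- have E : (b `&` e) `|` (b `&` c) = b `&` e.
    by apply: join_l; rewrite leI2.
  rewrite -[X in (_, X)]E; apply: (congruence_join _ cal).
    by apply: (congruence_meet _ cal) => //; apply: (congruence_refl _ cal).
  exact: (congruence_refl _ cal).
- have E : (a `&` e) `|` (b `&` e) = b `&` e.
    by apply: join_r; rewrite leI2.
  rewrite -[X in (_, X)]E; apply: (congruence_join _ cbe).
    exact: (congruence_refl _ cbe).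
  by apply: (congruence_meet _ cbe) => //; apply: (congruence_refl _ cbe).
Qed.

End TwoElementImage.

Local Close Scope order_scope.
Local Close Scope classical_set_scope.

Theorem proposition7p7 (d d' : Order.disp_t) (L : tbLatticeType d)
    (M : tbLatticeType d') (h : {lmorphism L -> M})
    (h0 : h \bot%O = \bot%O) (h1 : h \top%O = \top%O)
    (hL : range h = [set \bot%O; \top%O]%classic) :
  admissible h /\ Max_admissible h.
Proof.
split=> psi [psi_proper _]; first exact: pullback_Spec.
exact: pullback_Max.
Qed.
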